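(* Let $(\Gamma,g)$ be a repeated game with signals, $\Gamma=(X,I,J,C,D,\pi,q)$, $g:X\times I\times J\to[0,1]$, which is recursive with nonnegative payoffs. Then $(\Gamma,g)$ has a uniform value $v_\infty$; moreover the sup value $v^s$ and the limsup value $v^*$ exist and $v_\infty=v^s=v^*$. Furthermore, there exists a strategy of player 2 that guarantees $v_\infty$ in the uniform sense.
   Context: For a set $Y$, $\Delta_f(Y)$ is the set of probabilities with finite support on $Y$, and $\Delta(Y)$ (for $Y$ finite) the set of probabilities on $Y$. A repeated game form with signals $\Gamma=(X,I,J,C,D,\pi,q)$ consists of a set of states $X$, finite action sets $I$ (player 1) and $J$ (player 2), sets of signals $C$ (player 1) and $D$ (player 2), an initial distribution $\pi\in\Delta_f(X\times C\times D)$ and a transition $q:X\times I\times J\to\Delta_f(X\times C\times D)$. Play: $(x_1,c_1,d_1)$ is drawn from $\pi$; player 1 learns $c_1$, player 2 learns $d_1$. At each stage $n\ge1$ the players independently choose $i_n\in I$, $j_n\in J$; then $(x_{n+1},c_{n+1},d_{n+1})$ is drawn from $q(x_n,i_n,j_n)$, player 1 learns $c_{n+1}$, player 2 learns $d_{n+1}$. Each player remembers his own past signals and actions. A behavioral strategy of player 1 is a sequence $\sigma=(\sigma_n)_{n\ge1}$ with $\sigma_n:(C\times I)^{n-1}\times C\to\Delta(I)$; of player 2, $\tau=(\tau_n)_{n\ge1}$ with $\tau_n:(D\times J)^{n-1}\times D\to\Delta(J)$. The sets of strategies are $\Sigma$ and $\mathcal T$. A pair $(\sigma,\tau)$ induces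 a probability $\mathbb P_{\sigma,\tau}$ on plays $H_\infty=(X\times C\times D\times I\times J)^\infty$ (with the $\sigma$-algebra generated by cylinders), with expectation $\mathbb E_{\sigma,\tau}$. A state $x$ is absorbing if, for all actions, the probability to stay in $x$ is 1 and the payoff $g(x,i,j)$ does not depend on $(i,j)$. The game is recursive if $g=0$ outside the absorbing states; it is recursive and nonnegative if in addition all absorbing payoffs are nonnegative. Mean expected payoff: $\gamma_n(\sigma,\tau)=\mathbb E_{\sigma,\tau}\big(\frac1n\sum_{t=1}^n g(x_t,i_t,j_t)\big)$. A strategy $\sigma^*$ of player 1 guarantees $v\in\mathbb R$ in the uniform sense if for all $\eta>0$ there is $n_0\ge1$ such that $\gamma_n(\sigma^*,\tau)\ge v-\eta$ for all $n\ge n_0$ and all $\tau\in\mathcal T$. A strategy $\tau^*$ of player 2 guarantees $v$ in the uniform sense if for all $\eta>0$ there is $n_0\ge 1$ such that $\gamma_n(\sigma,\tau^* )\le v+\eta$ for all $n\ge n_0$ and all $\sigma\in\Sigma$. Player 1 (resp. player 2) can guarantee $v$ in the uniform sense if for all $\varepsilon>0$ he has a strategy which guarantees $v-\varepsilon$ (resp. $v+\varepsilon$) in the uniform sense. If both players can guarantee $v$ in the uniform sense, $v$ is the uniform value, denoted $v_\infty$. For a bounded evaluation $f$ of plays, the value, if it exists, is the common number $\sup_\sigma\inf_\tau\mathbb E_{\sigma,\tau}(f)=\inf_\tau\sup_\sigma\mathbb E_{\sigma,\tau}(f)$. The sup value $v^s$ is the value for $f=\gamma^s$, $\gamma^s(h)=\sup_{n\ge1}g(x_n,i_n,j_n)$;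 the limsup value $v^*$ is the value for $f=\gamma^*$, $\gamma^*(h)=\limsup_n g(x_n,i_n,j_n)$. *)

(* Defs.v *)
From HB Require Import structures.
From mathcomp Require Import all_boot all_order all_algebra.
From mathcomp Require Import all_classical all_reals all_analysis.
From mathcomp Require Import measurable_realfun.

Set Implicit Arguments.
Unset Strict Implicit.
Unset Printing Implicit Defensive.
Import Order.TTheory GRing.Theory Num.Theory.
Import numFieldNormedType.Exports.
Local Open Scope classical_set_scope.
Local Open Scope ring_scope.

Record fsprob (R : realType) (T : choiceType) := FSProb {
  mass :> T -> R ;
  mass_ge0 : forall y, 0 <= mass y ;
  mass_fin : finite_set [set y | mass y != 0] ;
  mass_sum1 : \sum_(y \in [set: T]) mass y = 1 }.

Lemma fsprob_inhabited (R : realType) (T : choiceType) (p : fsprob R T) :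
  exists y, p y != 0.
Proof.
apply: contrapT => /forallNP h.
have := mass_sum1 p; rewrite fsbig1; first by move/eqP; rewrite eq_sym oner_eq0.
by move=> y _; have /negP := h y; rewrite negbK => /eqP.
Qed.

Lemma mass_sum1E (R : realType) (T : choiceType) (p : fsprob R T)
    (A : set T) : finite_set A -> [set y | p y != 0] `<=` A ->
  \sum_(y \in A) p y = 1.
Proof.
move=> fA sA; rewrite -(mass_sum1 p); apply: fsbig_widen => // y [_ nAy] /=.
by apply/eqP; apply: contra_notT nAy => py; exact: sA.
Qed.

Section dprod.
Variables (R : realType) (A B : choiceType).
Variables (p : fsprob R A) (k : A -> fsprob R B).

Let m (z : A * B) : R := p z.1 * k z.1 z.2.
Let P := [set a | p a != 0].
Let Q := \bigcup_(a in P) [set b | k a b != 0].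

Let P_fin : finite_set P. Proof. exact: mass_fin. Qed.
Let Q_fin : finite_set Q.
Proof. by apply: bigcup_finite => // a _; exact: mass_fin. Qed.

Let m_supp : [set z | m z != 0] `<=` P `*` Q.
Proof.
move=> [a b] /=; rewrite /m /= mulf_eq0 negb_or => /andP[pa kab].
by split => //=; exists a.
Qed.

Let m_ge0 z : 0 <= m z. Proof. by rewrite mulr_ge0 ?mass_ge0. Qed.

Let m_fin : finite_set [set z | m z != 0].
Proof. by apply: sub_finite_set m_supp _; exact: finite_setX. Qed.

Let m_sum1 : \sum_(z \in [set: A * B]) m z = 1.
Proof.
rewrite -(@fsbig_widen _ _ _ _ (P `*` Q))//; last first.
  by move=> z [_ nz] /=; apply/eqP; apply: contra_notT nz => ?; exact: m_supp.
rewrite -(pair_fsbig _ (fun a b => p a * k a b))//.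
rewrite -(mass_sum1E P_fin (fun _ => id)).
apply: eq_fsbigr => a; rewrite inE => Pa.
rewrite -mulr_fsumr (mass_sum1E Q_fin) ?mulr1// => b kab.
by exists a.
Qed.

Definition fsdprod : fsprob R (A * B)%type := FSProb m_ge0 m_fin m_sum1.
End dprod.

(* Every set of finite sequences is allowed as the base of a cylinder, so that
   each coordinate carries its discrete sigma-algebra, even when S is
   uncountable. *)
Definition cylinders (S : Type) : set (set (nat -> S)) :=
  [set A | exists n (B : set (seq S)), A = [set h | B (mkseq h n)]].

Definition paths (S : pointedType) := g_sigma_algebraType (@cylinders S).

(* The law of the process whose next element, given the past s, has law K s,
   is the image of the uniform law on [0, 1[ under a map that cuts [0, 1[ into
   nested intervals, one for each finite path. *)
Section path_law.
Variables (R : realType) (S : pointedType) (K : seq S -> fsprob R S).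

Definition path_prob (s : seq S) : R :=
  \prod_(k < size s) K (take k s) (nth point s k).

Let L (s : seq S) : seq S := finmap.enum_fset (fset_set [set y | K s y != 0]).
Let cum (s : seq S) k : R := \sum_(y <- take k (L s)) K s y.

Let memL s y : (y \in L s) = (K s y != 0).
Proof.
rewrite /L in_fset_set; last exact: mass_fin.
by apply/idP/idP; rewrite inE.
Qed.

Let cum0 s : cum s 0 = 0. Proof. by rewrite /cum take0 big_nil. Qed.

Let cumS s k : (k < size (L s))%N ->
  cum s k.+1 = cum s k + K s (nth point (L s) k).
Proof.
move=> kL; rewrite /cum (take_nth point)//.
by rewrite -cats1 big_cat /= big_seq1.
Qed.

Let cum_size s : cum s (size (L s)) = 1.
Proof.
rewrite /cum take_size /L -fsbig_finite; last exact: mass_fin.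
by apply: mass_sum1E => //; exact: mass_fin.
Qed.

Let cum_le s j k : (j <= k)%N -> cum s j <= cum s k.
Proof.
move=> jk; rewrite /cum -(cat_take_drop j (take k (L s))) take_takel//.
by rewrite big_cat /= lerDl sumr_ge0// => i _; exact: mass_ge0.
Qed.

(* [left r, left r + path_prob (rev r)[ is the set of the u in [0, 1[ whose
   path starts with rev r *)
Let Fixpoint left (r : seq S) : R :=
  if r is y :: r' then
    left r' + path_prob (rev r') * cum (rev r') (index y (L (rev r'))) else 0.

Let step (r : seq S) (u : R) : S :=
  nth point (L (rev r))
    (find (fun k => u < left r + path_prob (rev r) * cum (rev r) k.+1)
          (iota 0 (size (L (rev r))))).

Let Fixpoint walk (n : nat) (u : R) : seq S :=
  if n is n'.+1 then step (walk n' u) u :: walk n' u else [::].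

Let path u : nat -> S := fun n => head point (walk n.+1 u).

Let size_walk n u : size (walk n u) = n.
Proof. by elim: n => //= n ->. Qed.

Let walk_path n u : rev (walk n u) = mkseq (path u) n.
Proof. by elim: n => //= n IH; rewrite rev_cons IH mkseqS. Qed.

Let itv r (u : R) := left r <= u < left r + path_prob (rev r).

Let path_prob_ge0 s : 0 <= path_prob s.
Proof. by apply: prodr_ge0 => k _; exact: mass_ge0. Qed.

Let path_prob_rcons s y : path_prob (rcons s y) = path_prob s * K s y.
Proof.
rewrite /path_prob size_rcons big_ord_recr /=; congr (_ * _).
  apply: eq_bigr => k _; rewrite nth_rcons ltn_ord -cats1 takel_cat//.
  exact: ltnW.
by rewrite -cats1 take_size_cat// nth_cat ltnn subnn.
Qed.

Let itv_cons r y u : itv (y :: r) u <-> itv r u /\ step r u = y.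
Proof.
rewrite /itv /= rev_cons path_prob_rcons.
set s := rev r; set p := path_prob s; set a := left r.
have p0 : 0 <= p by exact: path_prob_ge0.
rewrite -addrA -mulrDr /step -/s -/p -/a.
set f := (fun k => u < a + p * cum s k.+1).
have [yL|yL] := boolP (y \in L s); last first.
  have := yL; rewrite memL negbK => /eqP ->; rewrite addr0.
  split=> [/andP[h1 h2]|[/andP[h1 h2] hy]].
    by have := le_lt_trans h1 h2; rewrite ltxx.
  move: yL; rewrite -hy => /negP; case; apply: mem_nth.
  rewrite -[X in (_ < X)%N](size_iota 0) -has_find; apply/hasP.
  have L0 : (0 < size (L s))%N.
    rewrite lt0n; apply/eqP => L0; have := cum_size s.
    by rewrite L0 cum0 => /eqP; rewrite eq_sym oner_eq0.
  exists (size (L s)).-1; first by rewrite mem_iota leq0n add0n ltn_predL.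
  by rewrite /f prednK// cum_size mulr1.
have iL : (index y (L s) < size (L s))%N by rewrite index_mem.
have -> : cum s (index y (L s)) + K s y = cum s (index y (L s)).+1.
  by rewrite cumS// nth_index.
set i := index y (L s).
have LE : nth point (L s) i = y by rewrite nth_index.
have uL : uniq (L s) by exact: finmap.fset_uniq.
split=> [/andP[h1 h2]|[/andP[h1 h2] hy]].
  split.
    apply/andP; split.
      by apply: le_trans h1; rewrite lerDl mulr_ge0// -(cum0 s) cum_le.
    apply: lt_le_trans h2 _; rewrite lerD2l -[leRHS]mulr1 ler_wpM2l//.
    by rewrite -(cum_size s) cum_le.
  rewrite -LE; congr nth.
  have ->: size (L s) = (i + (size (L s) - i.+1).+1)%N.
    by rewrite -subSn// subSS subnKC// ltnW.
  rewrite iotaD find_cat add0n size_iota.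
  rewrite ifF /=; first by rewrite /f h2 addn0.
  apply/negbTE/hasPn => j; rewrite mem_iota add0n => /andP[_ ji].
  by rewrite /f -leNgt (le_trans _ h1)// lerD2l ler_wpM2l// cum_le.
have hf : has f (iota 0 (size (L s))).
  apply/hasP; exists (size (L s)).-1.
    by rewrite mem_iota add0n prednK ?leqnn //=; exact: leq_ltn_trans iL.
  rewrite /f prednK ?cum_size ?mulr1//; exact: leq_ltn_trans iL.
have fi : find f (iota 0 (size (L s))) = i.
  apply/eqP; rewrite -(nth_uniq point _ _ uL)//; first by rewrite hy LE.
  by have := hf; rewrite has_find size_iota.
apply/andP; split; last first.
  by have := nth_find 0%N hf; rewrite fi nth_iota// add0n.
case: i fi {LE iL} => [|i] fi; first by rewrite cum0 mulr0 addr0.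
have /(before_find 0%N) : (i < find f (iota 0 (size (L s))))%N by rewrite fi.
rewrite nth_iota ?add0n.
  by rewrite /f ltNge => /negbFE.
by have := hf; rewrite has_find size_iota fi; exact: ltn_trans.
Qed.

Let walkP r u : 0 <= u < 1 -> walk (size r) u = r <-> itv r u.
Proof.
move=> u01; elim: r => [|y r IH].
  by split => // _; rewrite /itv /= /path_prob big_ord0 add0r.
rewrite itv_cons /=; split.
  by move=> [h1 h2]; split; [apply/IH | rewrite -h1 h2].
by move=> [/IH h1 h2]; rewrite h1 h2.
Qed.

Let itv_01 r u : itv r u -> 0 <= u < 1.
Proof.
elim: r => [|y r IH]; last by rewrite itv_cons => -[/IH].
by rewrite /itv /= /path_prob big_ord0 add0r.
Qed.

Let D : set R := `[0, 1[%classic.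
Let mD : measurable D. Proof. exact: measurable_itv. Qed.

Let reach n : finite_set (walk n @` D).
Proof.
elim: n => [|n IH].
  by by apply: (@sub_finite_set _ _ [set [::]]) => [_ [u _ <-]|].
pose F r := (fun y => y :: r) @` [set y | K (rev r) y != 0].
apply: (@sub_finite_set _ _ (\bigcup_(r in walk n @` D) F r)).
  move=> _ [u Du <-]; exists (walk n u); first by exists u.
  exists (step (walk n u) u) => //=.
  have u01 : 0 <= u < 1 by move: Du; rewrite /D /= in_itv.
  have : itv (walk n.+1 u) u by apply/walkP => //; rewrite size_walk.
  rewrite /itv => /andP[h1 h2]; have := le_lt_trans h1 h2.
  rewrite ltrDl /= rev_cons path_prob_rcons => h; apply: contraTneq h => ->.
  by rewrite mulr0 ltxx.
apply: bigcup_finite => // r _; exact: (finite_image _ (mass_fin (K (rev r)))).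
Qed.

Let clip (u : R) : R := u * \1_D u.

Let clipD u : D (clip u).
Proof.
rewrite /clip indicE; have [uD|_] := boolP (u \in D).
  by rewrite mulr1; move: uD; rewrite inE.
by rewrite mulr0 /D /= in_itv /= lexx ltr01.
Qed.

Let clip_id u : D u -> clip u = u.
Proof. by move=> Du; rewrite /clip indicE mem_set// mulr1. Qed.

Let mclip : measurable_fun [set: R] clip.
Proof. by apply: measurable_funM => //; exact: measurable_indic. Qed.

Let itvE r : [set u | itv r u] = `[left r, left r + path_prob (rev r)[%classic.
Proof. by rewrite set_itvE. Qed.

Let f (u : R) : paths S := path (clip u).

Let mf : measurable_fun [set: R] f.
Proof.
apply: (@measurability _ _ _ (paths S) setT f (@cylinders S)) => //.
move=> _ [_ [n [B ->]] <-]; rewrite setTI.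
have -> : f @^-1` [set h | B (mkseq h n)] =
    clip @^-1` (\bigcup_(r in walk n @` D `&` [set r | B (rev r)])
       [set u | itv r u]).
  apply/seteqP; split=> u /=; have Du := clipD u;
    have u01 : 0 <= clip u < 1 by move: Du; rewrite /D /= in_itv.
    rewrite -walk_path => h; exists (walk n (clip u)).
      by split => //; exists (clip u).
    by apply/walkP => //; rewrite size_walk.
  move=> [r [[w Dw wr] Br]] /walkP; rewrite -{1}wr size_walk => /(_ u01) h.
  by rewrite /f -walk_path h.
rewrite -[_ @^-1` _]setTI; apply: mclip => //.
apply: fin_bigcup_measurable; first exact: finite_setIl.
by move=> r _; rewrite itvE; exact: measurable_itv.
Qed.

Let mu := mrestr (@lebesgue_measure R) mD.
Let mu1 : mu setT = 1%E.
Proof.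
by rewrite /mu /mrestr setTI /D lebesgue_measure_itv /= lte01 oppr0 adde0.
Qed.
HB.instance Definition _ := Measure.on mu.
HB.instance Definition _ := Measure_isProbability.Build _ _ _ mu mu1.

Lemma path_law_exists : exists P : probability (paths S) R,
  forall s, P [set h | mkseq h (size s) = s] = (path_prob s)%:E.
Proof.
pose F : {mfun (g_sigma_algebraType R.-ocitv.-measurable) >-> paths S} :=
  HB.pack (f : g_sigma_algebraType R.-ocitv.-measurable -> paths S)
    (isMeasurableFun.Build _ _ (g_sigma_algebraType R.-ocitv.-measurable)
       (paths S) f mf).
exists (distribution mu F) => s.
rewrite -[LHS]/(lebesgue_measure
  (f @^-1` [set h | mkseq h (size s) = s] `&` D)).
have -> : f @^-1` [set h | mkseq h (size s) = s] `&` D =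
    [set u | itv (rev s) u].
  apply/seteqP; split=> u /=.
    move=> [+ Du]; rewrite /f clip_id// -walk_path => h.
    apply/walkP; first by move: Du; rewrite /D /= in_itv.
    by rewrite size_rev -[in RHS]h revK.
  move=> h; have Du : D u by rewrite /D /= in_itv /=; exact: itv_01 h.
  split=> //; rewrite /f clip_id// -walk_path -[RHS]revK; congr rev.
  by rewrite -(size_rev s); apply/walkP => //; move: Du; rewrite /D /= in_itv.
rewrite itvE lebesgue_measure_itv /= lte_fin ltrDl revK.
have := path_prob_ge0 s; rewrite le_eqVlt => /orP[/eqP <-|p0].
  by rewrite ltxx.
by rewrite p0 -EFinB addrAC subrr add0r.
Qed.

End path_law.

(* Unique, since K s has finite support for every s. *)
Definition path_law (R : realType) (S : pointedType)
    (K : seq S -> fsprob R S) : probability (paths S) R :=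
  projT1 (cid (path_law_exists K)).

Lemma path_lawE (R : realType) (S : pointedType) (K : seq S -> fsprob R S)
    (s : seq S) :
  path_law K [set h | mkseq h (size s) = s] = (path_prob K s)%:E.
Proof. exact: (projT2 (cid (path_law_exists K))). Qed.

(* Without actions for one of the players there is no strategy and no play. *)
Record game_form (R : realType) (X C D : choiceType) (I J : finType) :=
  GameForm {
    init : fsprob R (X * C * D)%type ;
    trans : X -> I -> J -> fsprob R (X * C * D)%type ;
    actions1_gt0 : (0 < #|I|)%N ;
    actions2_gt0 : (0 < #|J|)%N }.

Definition stage (R : realType) (X C D : choiceType) (I J : finType)
  (G : game_form R X C D I J) : Type := (X * C * D * I * J)%type.

Section game.
Variables (R : realType) (X C D : choiceType) (I J : finType).
Variable G : game_form R X C D I J.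

Lemma stage_inhabited : exists s : stage G, True.
Proof.
have [y _] := fsprob_inhabited (init G).
have [i _] := card_gt0P (actions1_gt0 G).
have [j _] := card_gt0P (actions2_gt0 G).
by exists (y, i, j).
Qed.

HB.instance Definition _ := Choice.on (stage G).
HB.instance Definition _ :=
  isPointed.Build (stage G) (projT1 (cid stage_inhabited)).

Definition state_at (s : stage G) : X := s.1.1.1.1.
Definition signal1 (s : stage G) : C := s.1.1.1.2.
Definition signal2 (s : stage G) : D := s.1.1.2.
Definition action1 (s : stage G) : I := s.1.2.
Definition action2 (s : stage G) : J := s.2.

(* A play h is indexed from 0: h t is stage t.+1. *)
Definition play := paths (stage G).

(* The length of the first argument is the number of past stages, so that one
   function encodes the whole sequence of the maps
   (C * I)^(n-1) * C -> Delta(I). *)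
Definition strategy1 := seq (C * I) -> C -> fsprob R I.
Definition strategy2 := seq (D * J) -> D -> fsprob R J.

Definition draw (past : seq (stage G)) : fsprob R (X * C * D)%type :=
  if past is s :: past' then
    let s' := last s past' in trans G (state_at s') (action1 s') (action2 s')
  else init G.

Definition memory1 (past : seq (stage G)) : seq (C * I) :=
  [seq (signal1 s, action1 s) | s <- past].
Definition memory2 (past : seq (stage G)) : seq (D * J) :=
  [seq (signal2 s, action2 s) | s <- past].

Definition stage_law (sigma : strategy1) (tau : strategy2)
    (past : seq (stage G)) : fsprob R (stage G) :=
  fsdprod
    (fsdprod (draw past) (fun xcd => sigma (memory1 past) xcd.1.2))
    (fun xcdi => tau (memory2 past) xcdi.1.2).

Definition play_law (sigma : strategy1) (tau : strategy2) :
  probability play R := path_law (stage_law sigma tau).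

Variable g : X -> I -> J -> R.

Definition payoff (s : stage G) : R := g (state_at s) (action1 s) (action2 s).

Definition absorbing (x : X) : Prop :=
  (forall i j, \sum_(xcd \in [set xcd | xcd.1.1 = x]) trans G x i j xcd = 1) /\
  (forall i j i' j', g x i j = g x i' j').

Definition recursive : Prop := forall x, ~ absorbing x -> forall i j, g x i j = 0.

Definition recursive_nonneg : Prop :=
  recursive /\ (forall x, absorbing x -> forall i j, 0 <= g x i j).

Definition mean_payoff (n : nat) (sigma : strategy1) (tau : strategy2) :
    \bar R :=
  ('E_(play_law sigma tau)[fun h : play =>
     (n%:R^-1 * \sum_(t < n) payoff (h t))%R])%E.

Definition guarantees1 (sigma : strategy1) (v : R) : Prop :=
  forall eta : R, 0 < eta -> exists2 n0 : nat, (1 <= n0)%N &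
    forall (n : nat) (tau : strategy2), (n0 <= n)%N ->
      ((v - eta)%:E <= mean_payoff n sigma tau)%E.

Definition guarantees2 (tau : strategy2) (v : R) : Prop :=
  forall eta : R, 0 < eta -> exists2 n0 : nat, (1 <= n0)%N &
    forall (n : nat) (sigma : strategy1), (n0 <= n)%N ->
      (mean_payoff n sigma tau <= (v + eta)%:E)%E.

Definition uniform_value (v : R) : Prop :=
  (forall eps : R, 0 < eps -> exists sigma, guarantees1 sigma (v - eps)) /\
  (forall eps : R, 0 < eps -> exists tau, guarantees2 tau (v + eps)).

Definition has_value (f : play -> R) (v : R) : Prop :=
  ereal_sup [set ereal_inf [set ('E_(play_law sigma tau)[f])%E | tau in setT]
            | sigma in setT] = v%:E /\
  ereal_inf [set ereal_sup [set ('E_(play_law sigma tau)[f])%E | sigma in setT]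
            | tau in setT] = v%:E.

Definition sup_payoff (h : play) : R := sup (range (fun t => payoff (h t))).

Definition limsup_payoff (h : play) : R := limn_sup (fun t => payoff (h t)).

End game.

Arguments sup_payoff {R X C D I J} G g h.
Arguments limsup_payoff {R X C D I J} G g h.
Arguments has_value {R X C D I J} G f v.

(* Main.v *)
Require Import Defs.
From mathcomp Require Import all_boot all_order all_algebra.
From mathcomp Require Import finmap.
From mathcomp Require Import all_classical all_reals all_analysis.
From mathcomp Require Import measurable_realfun zify ring lra.

(** In a recursive game with nonnegative payoffs the payoff can only increase
    along a play: it is 0, the least possible value, until an absorbing state is
    reached, and constant afterwards ([payoff_nondecreasing]). Hence the
    expected payoff u sigma tau n of a stage is nondecreasing in n; its limit is
    the expectation of the supremum and also of the upper limit of the payoffs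
    ([expectation_limit]), while the mean payoff of n stages is the average of
    the first n values of u ([mean_payoffE]).

    Let v be the supremum, over the stages n and the strategies sigma, of the
    infimum over tau of u sigma tau n. If sigma secures v - e at stage n, then
    it secures v - e at all later stages, hence up to any eta in the mean,
    uniformly in tau ([guarantees1_stage]).

    The heart of the proof is a strategy tau of player 2 such that
    u sigma tau n <= v for all sigma and n at once ([optimal_response]); it
    bounds the means, the supremum and the upper limit. It is found as follows.
    - The payoff u is a finite sum, bilinear in the realization plans of the
      two players ([stage_payoffE]), and realization plans form a convex set,
      which is Kuhn's theorem ([plan_mixture]).
    - Given finitely many pairs (sigma, n), one may take n to be the same for
      all, since u increases with n; each convex combination of the sigma's is
      a strategy, against which player 2 has a reply giving at most v + e.
      A minimax argument ([approachability]) turns these replies into a single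
      tau that works for all the given pairs ([finite_response]).
    - The strategies of player 2 form a compact set for pointwise convergence
      and u is continuous there ([strategy_space_compact],
      [chain_continuous]), so that compactness gives one tau for all pairs. *)

Set Implicit Arguments.
Unset Strict Implicit.
Unset Printing Implicit Defensive.
Import Order.TTheory GRing.Theory Num.Theory.
Import numFieldNormedType.Exports.
Local Open Scope classical_set_scope.
Local Open Scope ring_scope.

(** * A minimax argument *)

(** A minimax theorem in the form needed here: if every nonnegative weighting w
    of the finitely many objectives A k admits a response t whose payoff,
    averaged with these weights, is at most v, then one response keeps all
    objectives below v + d.
    This is the approachability argument of Blackwell. One answers, again and
    again, the weights given by the positive parts of the cumulated excesses
    over v. The inner product of these weights with the next excess is then
    nonpositive, so the squared norm of the positive part grows only linearly
    with the number of answers, and the average excess tends to 0. *)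
Lemma approachability (R : realType) (K : finType) (T : Type)
    (A : K -> T -> R) (v : R) :
  (forall k t, `|A k t - v| <= 1) ->
  (forall p : bool -> R, (forall b, 0 <= p b) -> forall t : bool -> T,
    exists s, forall k, (\sum_b p b) * A k s = \sum_b p b * A k (t b)) ->
  (forall w : K -> R, (forall k, 0 <= w k) ->
    exists t, \sum_k w k * A k t <= (\sum_k w k) * v) ->
  forall d : R, 0 < d -> exists t, forall k, A k t <= v + d.
Proof.
move=> A1 Aconv Abr d d0.
pose r k t := A k t - v.
have rsq k t : r k t ^+ 2 <= 1.
  by rewrite -real_normK ?num_real// expr_le1//; exact: A1.
(* The excess cumulated over n.+1 responses is n.+1 times that of a single
   response, because the average of the responses is itself a response. *)
have step n : exists t,
    \sum_k (Num.max 0 (n.+1%:R * r k t)) ^+ 2 <= n.+1%:R * #|K|%:R.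
  elim: n => [|n [t IH]].
    have [t _] := Abr (fun=> 0) (fun=> lexx 0).
    exists t; rewrite mul1r -sum1_card natr_sum; apply: ler_sum => k _.
    rewrite mul1r maxEle; case: ifP => _; first exact: rsq.
    by rewrite expr0n ler01.
  pose w (k : K) : R := Num.max 0 (n.+1%:R * r k t).
  have w0 k : 0 <= w k by rewrite le_max lexx.
  have [u hu] := Abr w w0.
  have p0 (b : bool) : 0 <= (if b then n.+1%:R else 1 : R) by case: b.
  have [s hs] := Aconv _ p0 (fun b => if b then t else u).
  exists s.
  have rs k : n.+2%:R * r k s = n.+1%:R * r k t + r k u.
    have := hs k; rewrite !big_bool /= natr1 mul1r => h.
    by rewrite /r !mulrBr h -[n.+2%:R]natr1; ring.
  have le1 k : Num.max 0 (n.+2%:R * r k s) ^+ 2 <=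
      w k ^+ 2 + 2 * (w k * r k u) + 1.
    have : Num.max 0 (n.+2%:R * r k s) ^+ 2 <= (w k + r k u) ^+ 2.
      rewrite rs [X in X ^+ 2]maxEle; case: ifP => h; last first.
        by rewrite expr0n sqr_ge0.
      rewrite ler_sqr ?nnegrE//; first by rewrite lerD2r le_max lexx orbT.
      by rewrite (le_trans h)// lerD2r le_max lexx orbT.
    move/le_trans; apply; have := rsq k u.
    by move=> ru; rewrite [leLHS]sqrrD mulr_natl lerD2l.
  apply: (le_trans (ler_sum _ (fun k _ => le1 k))).
  (* The choice of u makes the cross term nonpositive. *)
  rewrite !big_split /= -mulr_sumr.
  have -> : \sum_(k : K) (1 : R) = #|K|%:R by rewrite -sum1_card natr_sum.
  have -> : \sum_k w k * r k u = \sum_k w k * A k u - (\sum_k w k) * v.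
    by rewrite mulr_suml -sumrB; apply: eq_bigr => k _; rewrite mulrBr.
  rewrite -[n.+2%:R]natr1 mulrDl mul1r; move: IH hu; rewrite -/w.
  by rewrite -/(w _); lra.
have [n nd] : exists n, #|K|%:R / d ^+ 2 < n.+1%:R :> R.
  exists (Num.truncn (#|K|%:R / d ^+ 2)).
  by rewrite truncnS_gt.
have [t ht] := step n; exists t => k.
rewrite -lerBlDl -/(r k t) -[_ <= _](ler_pM2l (ltr0Sn R n)).
have dn : 0 <= n.+1%:R * d by rewrite mulr_ge0// ltW.
suff : Num.max 0 (n.+1%:R * r k t) ^+ 2 <= (n.+1%:R * d) ^+ 2.
  by rewrite ler_sqr ?nnegrE// ?le_max ?lexx// ge_max => /andP[].
apply: (@le_trans _ _ (n.+1%:R * #|K|%:R)); last first.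
  rewrite exprMn expr2 -mulrA ler_wpM2l// -ler_pdivrMr ?exprn_gt0//.
  exact: ltW.
apply: le_trans ht; rewrite (bigD1 k)//= lerDl sumr_ge0// => j _.
exact: sqr_ge0.
Qed.

(** * Finite probabilities and products along a sequence *)

Section finite_law.
Variables (R : realType) (I : finType).

Lemma fsbig_finType (f : I -> R) : \sum_(i \in [set: I]) f i = \sum_i f i.
Proof.
rewrite -big_enum [RHS]fsbig_seq ?enum_uniq//.
suff -> : [set i | i \in enum I] = [set: I] by [].
by apply/seteqP; split=> i //= _; rewrite mem_enum.
Qed.

Lemma mass_sum_fin (p : fsprob R I) : \sum_i p i = 1.
Proof.
by rewrite -fsbig_finType mass_sum1.
Qed.

Lemma fsprob_exists (f : I -> R) : (forall i, 0 <= f i) -> \sum_i f i = 1 ->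
  exists p : fsprob R I, p =1 f.
Proof.
move=> f0 f1.
have h : \sum_(i \in [set: I]) f i = 1 by rewrite fsbig_finType.
by exists (@FSProb R I f f0 finite_finset h).
Qed.
End finite_law.

Lemma mass_full_eq0 (R : realType) (T : choiceType) (p : fsprob R T)
    (A : set T) y : \sum_(z \in A) p z = 1 -> ~ A y -> p y = 0.
Proof.
move=> pA nAy; apply/eqP; rewrite eq_le mass_ge0 andbT.
pose S : set T := y |` [set z | p z != 0].
have fS : finite_set S by rewrite finite_setU; split=> //; exact: mass_fin.
have := mass_sum1E fS (@subsetUr _ _ _).
rewrite (fsbigID A)//.
have -> : \sum_(z \in S `&` A) p z = 1.
  rewrite -pA; apply: fsbig_widen => [|z [Az nSz]]; first exact: subIsetr.
  apply/eqP; apply: contra_notT nSz => pz; split => //; by right.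
move/eqP; rewrite -subr_eq0 addrAC subrr add0r => /eqP h.
rewrite -h (fsbigD1 y)//=; last by split=> //; left.
  by rewrite lerDl fsumr_ge0// => z _; exact: mass_ge0.
exact: finite_setIl.
Qed.

Section chain.
Variables (R : realType) (T : Type).
Implicit Types (F : seq T -> T -> R) (past s : seq T).

(** [chain F s] is the product of the F p y over the prefixes rcons p y of s.
    Path probabilities and realization plans are all of this form; recursion
    with an accumulated past avoids a default element of T. *)
Fixpoint chain_from F past s : R :=
  if s is y :: s' then F past y * chain_from F (rcons past y) s' else 1.

Definition chain F := chain_from F [::].

Lemma chain_rcons F s y : chain F (rcons s y) = chain F s * F s y.
Proof.
rewrite /chain -[in F s]/([::] ++ s); elim: s [::] => /= [|x s IH] past.
  by rewrite cats0 mulr1 mul1r.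
by rewrite IH cat_rcons mulrA.
Qed.

Lemma chain_ge0 F s : (forall p y, 0 <= F p y) -> 0 <= chain F s.
Proof.
by move=> F0; rewrite /chain; elim: s [::] => //= y s IH p; rewrite mulr_ge0.
Qed.
End chain.

Lemma path_prob_chain (R : realType) (S : pointedType)
    (K : seq S -> fsprob R S) s : path_prob K s = chain K s.
Proof.
elim/last_ind: s => [|s y IH]; first by rewrite /path_prob big_ord0.
rewrite chain_rcons -IH /path_prob size_rcons big_ord_recr /=; congr (_ * _).
  apply: eq_bigr => k _; rewrite nth_rcons ltn_ord -cats1 takel_cat//.
  exact: ltnW.
by rewrite -cats1 take_size_cat// nth_cat ltnn subnn.
Qed.

(** * Realization plans *)

Section plan.
Variables (R : realType) (C : choiceType) (I : finType).

(** The realization plan of a behavioral strategy: the probability that it puts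
    on the player's own actions along a memory. By perfect recall the law of
    the play depends on the strategies only through their plans, and it is
    linear in each plan, whereas it is not linear in the strategies. *)
Definition plan (s : strategy1 R C I) : seq (C * I) -> R :=
  chain (fun m ci => s m ci.1 ci.2).

Lemma plan_ge0 s m : 0 <= plan s m.
Proof. by apply: chain_ge0 => p y; exact: mass_ge0. Qed.

(** Kuhn's theorem: the plans of behavioral strategies form a convex set. At a
    memory m, the strategy t is the average of the s k weighted by the
    posterior weights w k * plan (s k) m, that is, by how likely each s k is
    given that m has been reached. The fallback s0 is used at the memories
    whose total weight is 0, where the choice is immaterial. *)
Lemma plan_mixture (K : finType) (w : K -> R) (s : K -> strategy1 R C I)
    (s0 : strategy1 R C I) : (forall k, 0 <= w k) ->
  exists t, forall m, (\sum_k w k) * plan t m = \sum_k w k * plan (s k) m.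
Proof.
move=> w0; pose W m := \sum_k w k * plan (s k) m.
have wp0 m k : 0 <= w k * plan (s k) m by rewrite mulr_ge0// plan_ge0.
have condition m c : exists p : fsprob R I,
    forall i, W m * p i = \sum_k w k * plan (s k) m * s k m c i.
  have [W0|Wn0] := eqVneq (W m) 0.
    exists (s0 m c) => i; rewrite W0 mul0r big1// => k _.
    by rewrite (psumr_eq0P (fun k _ => wp0 m k) W0) ?mul0r.
  pose f i := (\sum_k w k * plan (s k) m * s k m c i) / W m.
  have f0 i : 0 <= f i.
    by rewrite divr_ge0 ?sumr_ge0// => k _; rewrite mulr_ge0 ?mass_ge0.
  have f1 : \sum_i f i = 1.
    rewrite -mulr_suml exchange_big /=.
    under eq_bigr do rewrite -mulr_sumr mass_sum_fin mulr1.
    by rewrite divff.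
  have [p pf] := fsprob_exists f0 f1.
  by exists p => i; rewrite pf mulrC divfK.
have [t ht] := choice (fun mc => condition mc.1 mc.2).
exists (fun m c => t (m, c)) => m; elim/last_ind: m => [|m ci IH].
  by rewrite mulr1; apply: eq_bigr => k _; rewrite mulr1.
rewrite /plan chain_rcons mulrA -/(plan _ m) IH -/(W m) (ht (m, ci.1)) /=.
by apply: eq_bigr => k _; rewrite chain_rcons mulrA.
Qed.
End plan.

(** * Expectations that depend on finitely many stages *)

(** L p lists finitely many possible successors of p. It need not be the exact
    support of K p, so that in the game one list serves all the strategies. *)
Section expectation.
Variables (R : realType) (S : pointedType) (K : seq S -> fsprob R S).
Variable L : seq S -> seq S.
Hypothesis L_uniq : forall p, uniq (L p).
Hypothesis L_supp : forall p y, K p y != 0 -> y \in L p.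

Fixpoint branches n : seq (seq S) :=
  if n is n'.+1 then [seq rcons p y | p <- branches n', y <- L p]
  else [:: [::]].

Lemma size_branches n p : p \in branches n -> size p = n.
Proof.
elim: n p => [|n IH] p /=; first by rewrite inE => /eqP ->.
by move=> /allpairsPdep[q [y [/IH <- _ ->]]]; rewrite size_rcons.
Qed.

Lemma branches_uniq n : uniq (branches n).
Proof.
elim: n => //= n IH; apply: allpairs_uniq_dep => // -[p y] [q z] _ _ /=.
by move=> /rcons_inj[-> ->].
Qed.

Lemma sum_branches n : \sum_(p <- branches n) path_prob K p = 1.
Proof.
elim: n => [|n IH] /=; first by rewrite big_seq1 /path_prob big_ord0.
rewrite big_allpairs_dep /= -[RHS]IH; apply: eq_bigr => p _.
under eq_bigr do rewrite path_prob_chain chain_rcons.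
rewrite -mulr_sumr -path_prob_chain fsbig_seq//.
rewrite (_ : \sum_(y \in _) _ = 1) ?mulr1//.
by apply: mass_sum1E => // y; exact: L_supp.
Qed.

Lemma measurable_prefix n (B : set (seq S)) :
  measurable ([set h | B (mkseq h n)] : set (paths S)).
Proof. by apply: sub_gen_smallest; exists n, B. Qed.

Lemma measurable_fun_prefix d (T : measurableType d) n (F : seq S -> T) :
  measurable_fun setT (fun h : paths S => F (mkseq h n)).
Proof.
by move=> _ B _; rewrite setTI; exact: (measurable_prefix n (F @^-1` B)).
Qed.

Lemma path_law_branch n p : p \in branches n ->
  path_law K [set h | mkseq h n = p] = (path_prob K p)%:E.
Proof. by move=> /size_branches <-; exact: path_lawE. Qed.

Lemma prefix_branches n :
  {ae path_law K, forall h, mkseq h n \in branches n}.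
Proof.
have mb : measurable ([set h | mkseq h n \in branches n] : set (paths S)).
  exact: (measurable_prefix n [set p | p \in branches n]).
exists (~` [set h | mkseq h n \in branches n]); split => //.
  exact: measurableC.
have bE : [set h | mkseq h n \in branches n] =
    \bigcup_(p in [set` branches n]) [set h | mkseq h n = p] :> set (paths S).
  apply/seteqP; split=> h /=; first by exists (mkseq h n).
  by move=> [p pb ->].
apply: etrans (probability_setC _ mb) _.
rewrite bE measure_fin_bigcup//=; last 2 first.
- by move=> p q _ _ [h [<- <-]].
- by move=> p _; exact: (measurable_prefix n [set p]).
rewrite (eq_fsbigr (fun p => (path_prob K p)%:E)); last first.
  by move=> p; rewrite inE; exact: path_law_branch.
by rewrite -fsbig_seq ?branches_uniq// sumEFin sum_branches subee.
Qed.

Lemma expectation_prefix n (F : seq S -> R) : (forall p, 0 <= F p) ->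
  ('E_(path_law K)[fun h => F (mkseq h n)] =
    (\sum_(p <- branches n) path_prob K p * F p)%:E)%E.
Proof.
move=> F0; rewrite unlock.
pose cyl p : set (paths S) := [set h | mkseq h n = p].
have mcyl p : measurable (cyl p) by exact: (measurable_prefix n [set p]).
have m1 p : measurable_fun setT 
      (fun h => (F p * \1_(cyl p) h)%:E).
  by apply/measurable_EFinP/measurable_funM => //; exact: measurable_indic.
have p1 p h : (0 <= (F p * \1_(cyl p) h)%:E)%E.
  by rewrite lee_fin mulr_ge0// indicE.
transitivity (\int[path_law K]_h
    \sum_(p <- branches n) (F p * \1_(cyl p) h)%:E)%E.
  apply: ge0_ae_eq_integral => //.
  - by apply/measurable_EFinP; exact: measurable_fun_prefix.
  - exact: emeasurable_sum.
  - by move=> h _; rewrite lee_fin.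
  - by move=> h _; rewrite sume_ge0.
  apply: (@filterS _ _ (ae_filter_ringOfSetsType (path_law K)) _ _ _
    (prefix_branches n)) => h hb _.
  rewrite (bigD1_seq (mkseq h n)) ?branches_uniq//= big1 ?adde0; last first.
    move=> p np; rewrite indicE memNset ?mulr0//.
    by apply: contraNnot np => ->.
  by rewrite indicE mem_set ?mulr1.
rewrite ge0_integral_sum// -sumEFin; apply: eq_big_seq => p pb.
under eq_integral do rewrite EFinM.
rewrite ge0_integralZl_EFin//; last first.
  by apply/measurable_EFinP; exact: measurable_indic.
by rewrite integral_indic// setIT [X in (_ * X)%E](path_law_branch pb) -EFinM
  mulrC.
Qed.
End expectation.

(** * Payoffs of the stages *)

Section game.
Variables (R : realType) (X C D : choiceType) (I J : finType).
Variables (G : game_form R X C D I J) (g : X -> I -> J -> R).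

Lemma draw_rcons (p : seq (stage G)) s :
  draw (rcons p s) = trans G (state_at s) (action1 s) (action2 s).
Proof. by case: p => //= s' p; rewrite last_rcons. Qed.

(** The part of a path's probability that is due to the draws of the states and
    of the signals, irrespective of the strategies. *)
Definition nature : seq (stage G) -> R :=
  chain (fun past s => draw past s.1.1).

Lemma nature_ge0 p : 0 <= nature p.
Proof. by apply: chain_ge0 => q s; exact: mass_ge0. Qed.

Lemma path_probE (sigma : strategy1 R C I) (tau : strategy2 R D J) p :
  path_prob (stage_law (G:=G) sigma tau) p =
    nature p * plan sigma (memory1 p) * plan tau (memory2 p).
Proof.
rewrite path_prob_chain; elim/last_ind: p => [|p s IH]; first by rewrite !mulr1.
rewrite /memory1 /memory2 !map_rcons /nature /plan !chain_rcons.
rewrite IH /stage_law /= -/(plan _ _) -/(plan _ _).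
rewrite -/(memory1 p) -/(memory2 p) -/(nature p).
rewrite /signal1 /signal2 /action1 /action2; ring.
Qed.

(** All actions are included, so that the support of every stage law, whatever
    the strategies, is covered. *)
Definition moves (past : seq (stage G)) : seq (stage G) :=
  [seq (yi, j) | yi <-
    [seq (y, i) | y <- finmap.enum_fset (fset_set [set y | draw past y != 0]),
                i <- enum I],
    j <- enum J].

Lemma moves_uniq past : uniq (moves past).
Proof.
apply: allpairs_uniq; [|exact: enum_uniq|by move=> [? ?] [? ?]].
by apply: allpairs_uniq; [|exact: enum_uniq|move=> [? ?] [? ?]].
Qed.

Lemma mem_moves past (s : stage G) :
  (s \in moves past) = (draw past s.1.1 != 0).
Proof.
apply/allpairsP/idP => [[[yi j] /= [/allpairsP[[y i] /= [+ _ ->]] _ ->]]|].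
  by rewrite in_fset_set ?inE//; exact: mass_fin.
case: s => [[y i] j] /= py; exists (y, i, j); split=> //=.
  apply/allpairsP; exists (y, i); split; rewrite ?mem_enum//=.
  by rewrite in_fset_set ?inE//; exact: mass_fin.
by rewrite mem_enum.
Qed.

Lemma moves_supp (sigma : strategy1 R C I) (tau : strategy2 R D J) past s :
  stage_law (G:=G) sigma tau past s != 0 -> s \in moves past.
Proof. by rewrite mem_moves !mulf_eq0 !negb_or => /andP[/andP[]]. Qed.

(** The expected payoff at stage n.+1, as a finite sum over the paths. *)
Definition stage_payoff (sigma : strategy1 R C I) (tau : strategy2 R D J) n :
    R :=
  \sum_(p <- branches moves n.+1)
    path_prob (stage_law (G:=G) sigma tau) p * payoff g (last point p).

(** Bilinearity in the realization plans. *)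
Lemma stage_payoffE sigma tau n : stage_payoff sigma tau n =
  \sum_(p <- branches moves n.+1) (nature p * payoff g (last point p)) *
    plan sigma (memory1 p) * plan tau (memory2 p).
Proof. by apply: eq_bigr => p _; rewrite path_probE; ring. Qed.

Lemma stage_payoff_mixture1 (K : finType) (w : K -> R)
    (s : K -> strategy1 R C I) (s0 : strategy1 R C I) : (forall k, 0 <= w k) ->
  exists sigma, forall tau n, (\sum_k w k) * stage_payoff sigma tau n =
    \sum_k w k * stage_payoff (s k) tau n.
Proof.
move=> w0; have [sigma hs] := plan_mixture s s0 w0.
exists sigma => tau n; under [RHS]eq_bigr do rewrite stage_payoffE mulr_sumr.
rewrite stage_payoffE exchange_big mulr_sumr; apply: eq_bigr => p _.
rewrite [RHS](eq_bigr (fun k => nature p * payoff g (last point p) *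
  plan tau (memory2 p) * (w k * plan (s k) (memory1 p)))).
  by rewrite -mulr_sumr -hs; ring.
by move=> k _; ring.
Qed.

Lemma stage_payoff_mixture2 (K : finType) (w : K -> R)
    (t : K -> strategy2 R D J) (t0 : strategy2 R D J) : (forall k, 0 <= w k) ->
  exists tau, forall sigma n, (\sum_k w k) * stage_payoff sigma tau n =
    \sum_k w k * stage_payoff sigma (t k) n.
Proof.
move=> w0; have [tau ht] := plan_mixture t t0 w0.
exists tau => sigma n; under [RHS]eq_bigr do rewrite stage_payoffE mulr_sumr.
rewrite stage_payoffE exchange_big mulr_sumr; apply: eq_bigr => p _.
rewrite [RHS](eq_bigr (fun k => nature p * payoff g (last point p) *
  plan sigma (memory1 p) * (w k * plan (t k) (memory2 p)))).
  by rewrite -mulr_sumr -ht; ring.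
by move=> k _; ring.
Qed.

Hypothesis g01 : forall x i j, 0 <= g x i j <= 1.

Let g0 (s : stage G) : 0 <= payoff g s.
Proof. by have /andP[] := g01 (state_at s) (action1 s) (action2 s). Qed.
Let g1 (s : stage G) : payoff g s <= 1.
Proof. by have /andP[] := g01 (state_at s) (action1 s) (action2 s). Qed.

Lemma stage_payoff_ge0 sigma tau n : 0 <= stage_payoff sigma tau n.
Proof.
rewrite sumr_ge0// => p _; rewrite mulr_ge0// path_probE.
by rewrite !mulr_ge0 ?nature_ge0 ?plan_ge0.
Qed.

Lemma stage_payoff_le1 sigma tau n : stage_payoff sigma tau n <= 1.
Proof.
rewrite -(sum_branches moves_uniq (@moves_supp sigma tau) n.+1).
apply: ler_sum => p _; rewrite ler_piMr// path_probE.
by rewrite !mulr_ge0 ?nature_ge0 ?plan_ge0.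
Qed.

Lemma payoff_prefix n : (fun h : play G => payoff g (h n)) =
  (fun h => (fun p => payoff g (last point p)) (mkseq h n.+1)).
Proof. by apply/funext => h; rewrite mkseqS last_rcons. Qed.

Lemma measurable_payoff n :
  measurable_fun setT (fun h : play G => payoff g (h n)).
Proof.
rewrite payoff_prefix; exact: (measurable_fun_prefix n.+1
  (fun p : seq (stage G) => payoff g (last point p))).
Qed.

Lemma expectation_payoff sigma tau n :
  ('E_(play_law G sigma tau)[fun h => payoff g (h n)] =
    (stage_payoff sigma tau n)%:E)%E.
Proof.
rewrite payoff_prefix.
exact: (expectation_prefix moves_uniq (@moves_supp sigma tau) n.+1
  (F := fun p => payoff g (last point p))).
Qed.

Hypothesis Grec : recursive_nonneg G g.

(** The only use of recursiveness: a nonabsorbing state pays 0, the least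
    possible payoff, while the payoff of an absorbing state is repeated. *)
Lemma payoff_nondecreasing n p (s s' : stage G) :
  rcons (rcons p s) s' \in branches moves n -> payoff g s <= payoff g s'.
Proof.
case: n => [|n] /=; first by rewrite inE -size_eq0 size_rcons.
move=> /allpairsPdep[q [y [_ + /rcons_inj[qE yE]]]].
rewrite mem_moves -{}qE -{}yE => s's.
have [Ax|nAx] := pselect (absorbing G g (state_at s)); last first.
  by rewrite {1}/payoff Grec.1.
have [Atr Ag] := Ax.
suff -> : payoff g s' = payoff g s by [].
rewrite /payoff (_ : state_at s' = state_at s); first exact: Ag.
apply: contrapT => ns; have /eqP := s's; apply.
rewrite draw_rcons.
exact: (mass_full_eq0 (Atr (action1 s) (action2 s))).
Qed.

Lemma ae_payoff_nondecreasing sigma tau :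
  {ae play_law G sigma tau, forall h : play G,
    nondecreasing_seq (fun n => payoff g (h n))}.
Proof.
have H n := prefix_branches moves_uniq (@moves_supp sigma tau) n.
have := ae_foralln H.
apply: (@filterS _ _ (ae_filter_ringOfSetsType (play_law G sigma tau))).
move=> h hb; apply/nondecreasing_seqP => n.
by have := hb n.+2; rewrite 2!mkseqS => /payoff_nondecreasing.
Qed.

Lemma stage_payoff_nondecreasing sigma tau :
  nondecreasing_seq (stage_payoff sigma tau).
Proof.
apply/nondecreasing_seqP => n; rewrite -lee_fin -!expectation_payoff.
apply: expectation_le => //; try exact: measurable_payoff.
have := ae_payoff_nondecreasing sigma tau.
apply: (@filterS _ _ (ae_filter_ringOfSetsType (play_law G sigma tau))).
by move=> h; apply.
Qed.

End game.

(** * The value and an optimal strategy of player 2 *)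

(** The finite intersection property, with the finite subfamilies indexed by
    finite types, as in [approachability]. *)
Lemma compact_family (T : topologicalType) (A : set T) (I : Type)
    (f : I -> set T) :
  compact A -> (forall i, closed (f i)) ->
  (forall (K : finType) (s : K -> I), exists2 x, A x & forall k, f (s k) x) ->
  exists2 x, A x & forall i, f i x.
Proof.
move=> cA cf fA.
pose B (s : {fset {classic I}}) := [set x | A x /\ forall i, i \in s -> f i x].
pose F := filter_from [set: {fset {classic I}}] B.
have FB s : F (B s) by exists s.
have FF : ProperFilter F.
  apply: filter_from_proper.
    apply: filter_from_filter => [|s t _ _]; first by exists fset0.
    exists (s `|` t)%fset => // x [Ax h].
    by split; split=> // i ist; apply: h; rewrite in_fsetU ist ?orbT.
  move=> s _; have [x Ax hx] := fA s (fun k => fsval k).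
  by exists x; split=> // i si; exact: (hx [` si]%fset).
have [|x [Ax xF]] := cA F FF; first by exists fset0 => // x [].
exists x => // i; apply: cf => U /xF; apply.
by exists [fset (i : {classic I})]%fset => // y [_]; apply; rewrite inE.
Qed.

Lemma chain_continuous (R : realType) (T : Type) (U : choiceType)
    (F : seq T -> T -> U) (s : seq T) :
  continuous (fun f : {ptws U -> R} => chain (fun p y => f (F p y)) s).
Proof.
elim/last_ind: s => [|s y IH]; first exact: cst_continuous.
have -> : (fun f : {ptws U -> R} => chain (fun p y => f (F p y)) (rcons s y)) =
    (fun f => chain (fun p y => f (F p y)) s) \* (fun f => f (F s y)).
  by apply/funext => f; rewrite chain_rcons.
move=> f; apply: (@continuousM R {ptws U -> R}); first exact: IH.
exact: (@proj_continuous U (fun=> R) (F s y)).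
Qed.

Section strategies.
Variables (R : realType) (C : choiceType) (I : finType).

Lemma strategy_exists : (0 < #|I|)%N -> exists s : strategy1 R C I, True.
Proof.
move=> /card_gt0P[i0 _].
have [||p _] := @fsprob_exists R I (fun i => (i == i0)%:R).
- by move=> i; exact: ler0n.
- by rewrite (bigD1 i0)//= eqxx big1 ?addr0// => i /negbTE ->.
by exists (fun _ _ => p).
Qed.

(** Behavioral strategies as points of a product of unit intervals, where
    Tychonoff's theorem applies; convergence is pointwise at each memory. *)
Definition strategy_space : set {ptws seq (C * I) * C * I -> R} :=
  [set f | forall z, `[0, 1]%classic (f z)] `&`
  \bigcap_(mc in [set: seq (C * I) * C]) [set f | \sum_i f (mc, i) = 1].

Lemma strategy_space_compact : compact strategy_space.
Proof.
pose B : set {ptws seq (C * I) * C * I -> R} :=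
  [set f | forall z, `[0, 1]%classic (f z)].
apply: (@subclosed_compact _ _ B); last 2 first.
- exact: (@tychonoff (seq (C * I) * C * I)%type (fun=> R)
    (fun=> `[0, 1]%classic) (fun=> @segment_compact R 0 1)).
- exact: subIsetl.
apply: closedI.
  rewrite (_ : [set _ | _] = \bigcap_(z in setT)
     ((fun f : {ptws seq (C * I) * C * I -> R} => f z) @^-1` `[0, 1]%classic)).
    apply: closed_bigI => z _; apply: preimage_closed.
      move=> f _.
      exact: (@proj_continuous (seq (C * I) * C * I)%type (fun=> R)).
    exact: itv_closed.
  by apply/seteqP; split=> f h z *; exact: h.
apply: closed_bigI => mc _.
apply: (@preimage_closed _ _
  (fun f : {ptws seq (C * I) * C * I -> R} => \sum_i f (mc, i))
  [set x : R | x = 1]); last exact: closed_eq.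
move=> f _; apply: (@continuous_big R I _ _ predT).
  exact: add_continuous.
by move=> i _; exact: (@proj_continuous (seq (C * I) * C * I)%type (fun=> R)).
Qed.

Lemma strategy_space_strategy f : strategy_space f ->
  exists s : strategy1 R C I, forall m c i, s m c i = f (m, c, i).
Proof.
move=> [f01 f1].
have [mc|s hs] := choice (X := (seq (C * I) * C)%type)
    (P := fun mc (p : fsprob R I) => forall i, p i = f (mc, i)).
  apply: fsprob_exists; last exact: f1.
  by move=> i; have := f01 (mc, i); rewrite /= in_itv /= => /andP[].
by exists (fun m c => s (m, c)).
Qed.

Lemma strategy_in_space (s : strategy1 R C I) :
  strategy_space (fun z => s z.1.1 z.1.2 z.2).
Proof.
split=> [[[m c] i]|[m c] _] /=; last exact: mass_sum_fin.
rewrite in_itv /= mass_ge0 /= -(mass_sum_fin (s m c)) (bigD1 i)//= lerDl.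
by rewrite sumr_ge0// => j _; exact: mass_ge0.
Qed.
End strategies.

Section value.
Variables (R : realType) (X C D : choiceType) (I J : finType).
Variables (G : game_form R X C D I J) (g : X -> I -> J -> R).
Hypothesis g01 : forall x i j, 0 <= g x i j <= 1.
Hypothesis Grec : recursive_nonneg G g.
Local Notation u := (@stage_payoff R X C D I J G g).

Definition lower_payoffs : set R :=
  [set r | exists sigma n, forall tau, r <= u sigma tau n].

(** The supremum over the stages of the maxmin of the payoff of that stage. *)
Definition value : R := sup lower_payoffs.

Let s0 : strategy1 R C I := projT1 (cid (strategy_exists R C (actions1_gt0 G))).
Let t0 : strategy2 R D J := projT1 (cid (strategy_exists R D (actions2_gt0 G))).

Lemma lower_payoffs_sup : has_sup lower_payoffs.
Proof.
split; first by exists 0, s0, 0%N => tau; exact: stage_payoff_ge0.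
exists 1 => r [sigma [n /(_ t0)/le_trans]]; apply; exact: stage_payoff_le1.
Qed.

Lemma value_ge0 : 0 <= value.
Proof.
apply: ub_le_sup; first exact: lower_payoffs_sup.2.
by exists s0, 0%N => tau; exact: stage_payoff_ge0.
Qed.

Lemma value_le1 : value <= 1.
Proof.
apply: ge_sup; first exact: lower_payoffs_sup.1.
by move=> r [sigma [n /(_ t0)/le_trans]]; apply; exact: stage_payoff_le1.
Qed.

Lemma value_attained eps : 0 < eps ->
  exists sigma n, forall tau, value - eps <= u sigma tau n.
Proof.
move=> e0; have [r [sigma [n h]] vr] := sup_adherent e0 lower_payoffs_sup.
by exists sigma, n => tau; exact: le_trans (ltW vr) (h tau).
Qed.

Lemma value_response sigma n eps : 0 < eps ->
  exists tau, u sigma tau n <= value + eps.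
Proof.
move=> e0; apply: contrapT => /forallNP h.
have : lower_payoffs (value + eps).
  by exists sigma, n => tau; apply/ltW; rewrite ltNge; apply/negP/h.
move/(ub_le_sup lower_payoffs_sup.2); rewrite -/value.
by rewrite gerDl leNgt e0.
Qed.

(** The stages n k are replaced by the latest of them, at which the payoffs are
    the largest; a weighting of the s k is then one strategy of player 1, to
    which player 2 has a good reply. *)
Lemma finite_response (K : finType) (s : K -> strategy1 R C I) (n : K -> nat)
    eps : 0 < eps ->
  exists tau, forall k, u (s k) tau (n k) <= value + eps.
Proof.
move=> e0; have e20 : 0 < eps / 2 by rewrite divr_gt0.
have [v1|v1] := leP (value + eps / 2) 1; last first.
  exists t0 => k; apply: le_trans (stage_payoff_le1 G g01 (s k) t0 (n k)) _.
  by move: v1; lra.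
have [||||tau htau] := @approachability R K (strategy2 R D J)
  (fun k tau => u (s k) tau (n k)) (value + eps / 2) _ _ _ (eps / 2) => //.
- move=> k tau; rewrite ler_norml.
  have := stage_payoff_ge0 G g01 (s k) tau (n k).
  have := stage_payoff_le1 G g01 (s k) tau (n k).
  by have := value_ge0; move: v1; lra.
- move=> p p0 t; have [tau ht] := stage_payoff_mixture2 G g t t0 p0.
  by exists tau => k; exact: ht.
- move=> w w0; have [sigma hs] := stage_payoff_mixture1 G g s s0 w0.
  have [tau ht] := value_response sigma (\max_k n k)%N e20.
  exists tau; apply: (@le_trans _ _ (\sum_k w k * u (s k) tau (\max_k n k)%N)).
    apply: ler_sum => k _; rewrite ler_wpM2l//.
    by apply: stage_payoff_nondecreasing => //; exact: leq_bigmax.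
  by rewrite -hs ler_wpM2l// sumr_ge0.
by exists tau => k; rewrite (le_trans (htau k))// -addrA -splitr.
Qed.

(** The conditions u sigma tau n <= value + e are closed in tau, since u only
    involves finitely many coordinates of tau; any finitely many of them can be
    met together, so compactness yields one tau that meets them all. *)
Lemma optimal_response : exists tau, forall sigma n, u sigma tau n <= value.
Proof.
pose E (f : {ptws seq (D * J) * D * J -> R}) sigma n : R :=
  \sum_(p <- branches (@moves _ _ _ _ _ _ G) n.+1)
    (nature p * payoff g (last point p)) * plan sigma (memory1 p) *
    chain (fun m ci => f (m, ci.1, ci.2)) (memory2 p).
have Eu f (tau : strategy2 R D J) sigma n :
    (forall m c i, tau m c i = f (m, c, i)) -> E f sigma n = u sigma tau n.
  move=> tf; rewrite stage_payoffE; apply: eq_bigr => p _; congr (_ * _).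
  rewrite /plan; congr chain; apply/funext => m; apply/funext => ci.
  by rewrite tf.
pose K (z : strategy1 R C I * nat * {posnum R}) :=
  [set f | E f z.1.1 z.1.2 <= value + z.2%:num].
have [||f fS fK] := compact_family (f := K) (@strategy_space_compact R D J).
- move=> [[sigma n] e].
  apply: (@preimage_closed _ _ (fun f => E f sigma n) [set x | x <= _]);
    last exact: closed_le.
  move=> f _; apply: (@continuous_big R _ _ _ predT).
    exact: add_continuous.
  move=> p _ {}f.
  apply: (@continuousM R {ptws seq (D * J) * D * J -> R}
    (cst (nature p * payoff g (last point p) * plan sigma (memory1 p)))
    (fun f => chain (fun m ci => f (m, ci.1, ci.2)) (memory2 p))).
    exact: cst_continuous.
  have := @chain_continuous R (D * J)%type (seq (D * J) * D * J)%type
    (fun m ci => (m, ci.1, ci.2)) (memory2 p) f.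
  exact.
- move=> L s.
  pose e := \big[Order.min/1]_(k : L) (s k).2%:num.
  have e0 : 0 < e by apply: lt_bigmin.
  have [tau ht] := finite_response (fun k => (s k).1.1) (fun k => (s k).1.2) e0.
  exists (fun z => tau z.1.1 z.1.2 z.2); first exact: strategy_in_space.
  move=> k; rewrite /K /= (Eu _ tau)//; apply: le_trans (ht k) _.
  by rewrite lerD2l bigmin_le_cond.
have [tau tf] := strategy_space_strategy fS.
exists tau => sigma n; apply/ler_addgt0Pr => e e0.
by rewrite -(Eu f)//; exact: (fK (sigma, n, PosNum e0)).
Qed.

End value.

(** * From stage payoffs to the evaluations of plays *)

Section evaluation.
Variables (R : realType) (X C D : choiceType) (I J : finType).
Variables (G : game_form R X C D I J) (g : X -> I -> J -> R).
Hypothesis g01 : forall x i j, 0 <= g x i j <= 1.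
Hypothesis Grec : recursive_nonneg G g.
Local Notation u := (@stage_payoff R X C D I J G g).
Local Notation v := (value G g).

Let g0 (s : stage G) : 0 <= payoff g s.
Proof. by have /andP[] := g01 (state_at s) (action1 s) (action2 s). Qed.
Let g1 (s : stage G) : payoff g s <= 1.
Proof. by have /andP[] := g01 (state_at s) (action1 s) (action2 s). Qed.

(** By dominated convergence. The supremum and the upper limit of the payoffs
    both qualify as F, the payoffs being nondecreasing along almost every
    play. *)
Lemma expectation_limit sigma tau (F : play G -> R) :
  measurable_fun setT F ->
  {ae play_law G sigma tau, forall h : play G,
    (fun n => payoff g (h n)) @ \oo --> F h} ->
  ('E_(play_law G sigma tau)[F] = (sup (range (u sigma tau)))%:E)%E.
Proof.
move=> mF cF; rewrite unlock.
have [||||| _ _ cI] := @dominated_convergence _ _ _ (play_law G sigma tau)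
    setT measurableT (fun n (h : play G) => (payoff g (h n))%:E)
    (EFin \o F) (cst 1%E).
- by move=> n; apply/measurable_EFinP; exact: measurable_payoff.
- exact/measurable_EFinP.
- move: cF; apply: (@filterS _ _
    (ae_filter_ringOfSetsType (play_law G sigma tau))) => h hF _.
  by apply: cvg_EFin; [exact: nearW|exact: hF].
- exact: finite_measure_integrable_cst.
- apply: aeW => h n _; rewrite /= lee_fin ger0_norm//.
have uE : [sequence \int[play_law G sigma tau]_h (payoff g (h n))%:E]_n%E =
    EFin \o u sigma tau.
  apply/funext => n /=.
  by rewrite -(expectation_payoff G g01) unlock.
rewrite uE in cI; apply: (cvg_unique _ cI) => //.
apply: cvg_EFin; first exact: nearW.
apply: nondecreasing_cvgn; first exact: stage_payoff_nondecreasing.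
by exists 1 => _ [n _ <-]; exact: stage_payoff_le1.
Qed.

(** Player 2 plays his optimal response; player 1 plays a strategy that is
    nearly optimal at one stage, which the later stages can only improve. *)
Lemma has_valueP (F : play G -> R) :
  (forall sigma tau,
    ('E_(play_law G sigma tau)[F] = (sup (range (u sigma tau)))%:E)%E) ->
  has_value G F v.
Proof.
move=> EF.
have ubu sigma tau : has_ubound (range (u sigma tau)).
  by exists 1 => _ [n _ <-]; exact: stage_payoff_le1.
have lo e : 0 < e -> exists sigma, forall tau,
    ((v - e)%:E <= 'E_(play_law G sigma tau)[F])%E.
  move=> e0; have [sigma [n h]] := value_attained G g01 e0.
  exists sigma => tau; rewrite EF lee_fin; apply: le_trans (h tau) _.
  by apply: ub_le_sup => //; exists n.
have [tau0 h0] := optimal_response g01 Grec.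
have up sigma : ('E_(play_law G sigma tau0)[F] <= v%:E)%E.
  rewrite EF lee_fin; apply: ge_sup; first by exists (u sigma tau0 0%N), 0%N.
  by move=> _ [n _ <-].
split; apply/eqP; rewrite eq_le; apply/andP; split.
- apply: ge_ereal_sup => _ [sigma _ <-].
  by apply: le_trans (up sigma); apply: ereal_inf_lbound; exists tau0.
- apply/lee_addgt0Pr => e e0; rewrite -leeBlDr// -EFinB.
  have [sigma h] := lo e e0.
  apply: (@le_trans _ _ (ereal_inf
    [set ('E_(play_law G sigma tau)[F])%E | tau in setT])).
    by apply: le_ereal_inf_tmp => _ [tau _ <-].
  by apply: ereal_sup_ubound; exists sigma.
- apply: (@le_trans _ _ (ereal_sup
    [set ('E_(play_law G sigma tau0)[F])%E | sigma in setT])).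
    by apply: ereal_inf_lbound; exists tau0.
  by apply: ge_ereal_sup => _ [sigma _ <-].
- apply: le_ereal_inf_tmp => _ [tau _ <-].
  apply/lee_addgt0Pr => e e0; rewrite -leeBlDr// -EFinB.
  have [sigma h] := lo e e0; apply: le_trans (h tau) _.
  by apply: ereal_sup_ubound; exists sigma.
Qed.

Lemma mean_payoffE n sigma tau :
  mean_payoff G g n sigma tau = (n%:R^-1 * \sum_(t < n) u sigma tau t)%:E.
Proof.
have mp t : measurable_fun setT (fun h : play G => (payoff g (h t))%:E).
  by apply/measurable_EFinP; exact: measurable_payoff.
rewrite /mean_payoff unlock; under eq_integral do rewrite EFinM -sumEFin.
rewrite ge0_integralZl_EFin//; last 2 first.
- by move=> h _; apply: sume_ge0 => t _; rewrite lee_fin.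
- exact: emeasurable_sum.
rewrite ge0_integral_sum//; last by move=> t h _; rewrite lee_fin.
rewrite EFinM -sumEFin; congr (_ * _)%E; apply: eq_bigr => t _.
by rewrite -(expectation_payoff G g01) unlock.
Qed.

(** The first N stages, where the payoffs may be 0, lower the mean of n payoffs
    below w by at most N / n, since w <= 1. This bound does not depend on
    tau. *)
Lemma guarantees1_stage sigma w N : w <= 1 ->
  (forall tau, w <= u sigma tau N) -> guarantees1 G g sigma w.
Proof.
move=> w1 wu eta eta0; exists (Num.truncn (N%:R / eta)).+1 => // n tau nn.
have n0 : 0 < n%:R :> R by rewrite ltr0n; exact: leq_trans nn.
rewrite mean_payoffE lee_fin mulrC ler_pdivlMr//.
have Nn : N%:R <= n%:R * eta.
  rewrite -ler_pdivrMr//; apply: le_trans (ltW (truncnS_gt _)) _.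
  by rewrite ler_nat.
have le_term (t : 'I_n) : w - (t < N)%:R <= u sigma tau t.
  case: ltnP => [tN|Nt].
    by rewrite (le_trans _ (stage_payoff_ge0 _ _ _ _ _))// subr_le0.
  rewrite subr0; apply: le_trans (wu tau) _.
  exact: stage_payoff_nondecreasing.
apply: (le_trans _ (ler_sum _ (fun t _ => le_term t))).
rewrite sumrB sumr_const card_ord -[w *+ n]mulr_natr mulrBl lerD2l lerN2.
rewrite -natr_sum (le_trans _ (le_trans Nn _)) ?ler_nat// 1?mulrC//.
suff -> : (\sum_(t < n) (t < N) = minn n N)%N by exact: geq_minr.
elim: (n) => [|k IH]; first by rewrite big_ord0 min0n.
by rewrite big_ord_recr /= IH; case: ltnP => ?; lia.
Qed.

Lemma guarantees2_stage tau w :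
  (forall sigma n, u sigma tau n <= w) -> guarantees2 G g tau w.
Proof.
move=> uw eta eta0; exists 1%N => // n sigma n0.
rewrite mean_payoffE lee_fin ler_pdivrMl ?ltr0n//.
apply: (@le_trans _ _ (n%:R * w)).
  by rewrite mulr_natl -[n in w *+ n]card_ord -sumr_const ler_sum.
by rewrite ler_wpM2l// lerDl ltW.
Qed.

Let has_bounds (h : play G) : has_ubound (range (fun n => payoff g (h n))) /\
  has_lbound (range (fun n => payoff g (h n))).
Proof. by split; [exists 1|exists 0] => _ [n _ <-]. Qed.

Lemma sup_payoff_value : has_value G (sup_payoff G g) v.
Proof.
apply: has_valueP => sigma tau; apply: expectation_limit.
  rewrite (_ : sup_payoff G g = fun h => sups (fun n => payoff g (h n)) 0%N).
    apply: (measurable_fun_sups (h := fun n (h : play G) => payoff g (h n))).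
      by move=> h _; exact: (has_bounds h).1.
    by move=> n; exact: measurable_payoff.
  apply/funext => h; congr sup; apply/seteqP.
  by split=> _ [n _ <-]; exists n.
move: (ae_payoff_nondecreasing g01 Grec sigma tau).
apply: (@filterS _ _ (ae_filter_ringOfSetsType (play_law G sigma tau))) => h hn.
exact: nondecreasing_cvgn hn (has_bounds h).1.
Qed.

Lemma limsup_payoff_value : has_value G (limsup_payoff G g) v.
Proof.
apply: has_valueP => sigma tau; apply: expectation_limit.
  apply: (measurable_fun_limn_sup (h := fun n (h : play G) => payoff g (h n))).
  - by move=> h _; exact: (has_bounds h).1.
  - by move=> h _; exact: (has_bounds h).2.
  - by move=> n; exact: measurable_payoff.
move: (ae_payoff_nondecreasing g01 Grec sigma tau).
apply: (@filterS _ _ (ae_filter_ringOfSetsType (play_law G sigma tau))) => h hn.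
have ch := nondecreasing_cvgn hn (has_bounds h).1.
rewrite /limsup_payoff cvg_limn_supE; last exact: cvgP ch.
by rewrite (cvg_lim _ ch).
Qed.

End evaluation.

Theorem theorem24 (R : realType) (X C D : choiceType) (I J : finType)
    (G : game_form R X C D I J) (g : X -> I -> J -> R)
    (g01 : forall x i j, 0 <= g x i j <= 1)
    (Grec : recursive_nonneg G g) :
  exists v : R,
    [/\ uniform_value G g v,
        has_value G (sup_payoff G g) v,
        has_value G (limsup_payoff G g) v &
        exists tau : strategy2 R D J, guarantees2 G g tau v].
Proof.
have [tau htau] := optimal_response g01 Grec.
exists (value G g); split.
- split=> eps eps0.
    have [sigma [n h]] := value_attained G g01 eps0.
    exists sigma; apply: (guarantees1_stage g01 Grec _ h).
    by have := value_le1 G g01; lra.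
  exists tau; apply: guarantees2_stage => // sigma n.
  by rewrite (le_trans (htau sigma n))// lerDl ltW.
- exact: sup_payoff_value.
- exact: limsup_payoff_value.
- by exists tau; exact: guarantees2_stage.
Qed.
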